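(* Let $R$ be a unital ring and let $G$ be a subgroup of $\mathrm{GL}(R)$. Suppose that there exists a subset $E \subseteq \mathrm{E}(R)$ satisfying the following conditions: (A) There exists a sequence $(e_n)_{n \in \mathbb{N}} \in E^{\mathbb{N}}$ such that, for every sequence $(h_n)_{n\in\mathbb{N}}$ with $h_n \in G(e_n)$ for all $n \in \mathbb{N}$, there exists $g \in G$ such that $e_n g = g e_n = h_n e_n$ for all $n \in \mathbb{N}$. (B) For every $e \in E$, there exist a finite subset $F \subseteq G(e)$, $m \in \mathbb{N}$ and $f \in E$ with $G(f) \subseteq \mathrm{Cl}_{G(e)}(F)^m$. (C) For every $e \in E$, there exist a finite subset $F \subseteq G$ and $\ell \in \mathbb{N}$ such that $G = (G(e) \cup F)^{\ell}$. Then $G$ has uncountable strong cofinality.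
   Context: For a unital ring $R$, $\mathrm{GL}(R)$ is the group of units of $R$ and $\mathrm{E}(R) = \{ e \in R \mid e^2 = e \}$. For $e \in \mathrm{E}(R)$, $eRe$ is a ring with multiplicative unit $e$, and $\Gamma_R(e) = \{ a + 1 - e \mid a \in \mathrm{GL}(eRe) \} = \mathrm{GL}(R) \cap (eRe + 1 - e)$, which is a subgroup of $\mathrm{GL}(R)$. For a subgroup $G \leq \mathrm{GL}(R)$ and $e \in \mathrm{E}(R)$, $G(e) = G \cap \Gamma_R(e)$. For a group $H$ and $S \subseteq H$, $\mathrm{Cl}_H(S) = \{ h s h^{-1} \mid s \in S, \, h \in H \}$. For a subset $W$ of a group and $m \in \mathbb{N}$, $W^m = \{ w_1 \cdots w_m \mid w_1,\ldots,w_m \in W \}$. A group $G$ has uncountable strong cofinality if, for every sequence $(W_n)_{n \in \mathbb{N}}$ of subsets of $G$ with $W_n \subseteq W_{n+1}$ for all $n$ and $\bigcup_{n \in \mathbb{N}} W_n = G$, there exist $m,n \in \mathbb{N}$ such that $W_n^m = G$. *)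

(* Defs.v *)
From HB Require Import structures.
From mathcomp Require Import all_boot all_algebra.
From mathcomp Require Import boolp classical_sets cardinality.

Set Implicit Arguments.
Unset Strict Implicit.
Unset Printing Implicit Defensive.

Import GRing.Theory.

Local Open Scope classical_set_scope.
Local Open Scope ring_scope.

(* [pzRingType] is the class of possibly zero unital rings; the library defines
   units only over [unitRingType], which excludes the zero ring, so GL(R) is
   built here directly. *)
Definition is_unit (R : pzRingType) (x : R) : Prop :=
  exists y : R, x * y = 1 /\ y * x = 1.

Record GL (R : pzRingType) := MkGL {
  ring_of_GL : R;
  _ : `[< is_unit ring_of_GL >]
}.

Section GLGroup.
Context (R : pzRingType).

HB.instance Definition _ := [isSub for @ring_of_GL R].
HB.instance Definition _ := [Choice of GL R by <:].

Lemma is_unit_GL (u : GL R) : is_unit (ring_of_GL u).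
Proof. exact/asboolP/(valP u). Qed.

Let inv_val (u : GL R) : R := sval (cid (is_unit_GL u)).

Let inv_valP (u : GL R) :
  ring_of_GL u * inv_val u = 1 /\ inv_val u * ring_of_GL u = 1.
Proof. exact: svalP (cid (is_unit_GL u)). Qed.

Let one_unit : `[< is_unit (1 : R) >].
Proof. by apply/asboolP; exists 1; rewrite mulr1. Qed.

Let mul_unit (u v : GL R) : `[< is_unit (ring_of_GL u * ring_of_GL v) >].
Proof.
have [uu' u'u] := inv_valP u; have [vv' v'v] := inv_valP v.
apply/asboolP; exists (inv_val v * inv_val u); split.
  by rewrite mulrA -(mulrA (ring_of_GL u)) vv' mulr1.
by rewrite mulrA -(mulrA (inv_val v)) u'u mulr1.
Qed.

Let inv_unit (u : GL R) : `[< is_unit (inv_val u) >].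
Proof. by apply/asboolP; have [] := inv_valP u; exists (ring_of_GL u). Qed.

Definition GLone : GL R := MkGL one_unit.
Definition GLmul (u v : GL R) : GL R := MkGL (mul_unit u v).
Definition GLinv (u : GL R) : GL R := MkGL (inv_unit u).

Let GLmulA : associative GLmul.
Proof. by move=> u v w; apply: val_inj; rewrite /= mulrA. Qed.

Let GLmul1 : left_id GLone GLmul.
Proof. by move=> u; apply: val_inj; rewrite /= mul1r. Qed.

Let GLmulr1 : right_id GLone GLmul.
Proof. by move=> u; apply: val_inj; rewrite /= mulr1. Qed.

Let GLmulV : left_inverse GLone GLinv GLmul.
Proof. by move=> u; apply: val_inj; have [] := inv_valP u. Qed.

Let GLmulrV : right_inverse GLone GLinv GLmul.
Proof. by move=> u; apply: val_inj; have [] := inv_valP u. Qed.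

HB.instance Definition _ :=
  isGroup.Build (GL R) GLmulA GLmul1 GLmulr1 GLmulV GLmulrV.

Lemma ring_of_GL1 : ring_of_GL (1%g : GL R) = 1.
Proof. by []. Qed.

Lemma ring_of_GLM (u v : GL R) :
  ring_of_GL (u * v)%g = ring_of_GL u * ring_of_GL v.
Proof. by []. Qed.

End GLGroup.

Section Groups.
Context (H : groupType).
Local Open Scope group_scope.

Definition is_subgroup (G : set H) : Prop :=
  [/\ G 1, forall x y, G x -> G y -> G (x * y) & forall x, G x -> G x^-1].

Definition Cl (K S : set H) : set H :=
  [set h * s * h^-1 | s in S & h in K].

(* [set_pow W 0] is the trivial subgroup, as the empty product is 1. *)
Definition set_pow (W : set H) (m : nat) : set H :=
  [set \prod_(i < m) w i | w in [set w : 'I_m -> H | forall i, W (w i)]].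

(* Here G is meant to be a subgroup of H, regarded as a group in its own right;
   the covering condition makes every W n a subset of G. *)
Definition uncountable_strong_cofinality (G : set H) : Prop :=
  forall W : nat -> set H,
    (forall n, W n `<=` W n.+1) -> \bigcup_n W n = G ->
    exists m n : nat, set_pow (W n) m = G.

End Groups.

Section Corners.
Context (R : pzRingType).

Definition idempotents : set R := [set e | e ^+ 2 = e].

Definition corner (e : R) : set R := [set e * x * e | x in [set: R]].

(* The multiplicative unit of the ring eRe is e. *)
Definition GLcorner (e : R) : set R :=
  [set a | corner e a /\ exists2 b, corner e b & a * b = e /\ b * a = e].

Definition Gamma (e : R) : set (GL R) :=
  [set u | exists2 a, GLcorner e a & ring_of_GL u = a + 1 - e].

Lemma corner_id (e a : R) :
  idempotents e -> corner e a -> e * a = a /\ a * e = a.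
Proof.
rewrite /idempotents /= expr2 => ee [x _ <-].
by rewrite !mulrA ee -!mulrA ee.
Qed.

Lemma Gamma_image (e : R) : idempotents e ->
  @ring_of_GL R @` Gamma e = [set a + 1 - e | a in GLcorner e].
Proof.
move=> ee; apply/seteqP; split => [_ [u [a aG ua] <-]|_ [a aG <-]].
  by exists a.
have main x y : corner e x -> corner e y -> x * y = e ->
    (x + 1 - e) * (y + 1 - e) = 1.
  move=> /(corner_id ee)[ex xe] /(corner_id ee)[ey ye] xy.
  have e2 : e * e = e by rewrite -expr2.
  have x0 : x * (1 - e) = 0 by rewrite mulrBr mulr1 xe subrr.
  have y0 : (1 - e) * y = 0 by rewrite mulrBl mul1r ey subrr.
  have e0 : (1 - e) * (1 - e) = 1 - e.
    by rewrite mulrBr mulr1 mulrBl mul1r e2 subrr subr0.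
  rewrite -!addrA mulrDl (mulrDr x) (mulrDr (1 - e)) xy x0 y0 e0 addr0 add0r.
  by rewrite addrC subrK.
have [aC [b bC [ab ba]]] := aG.
have uP : `[< is_unit (a + 1 - e) >].
  by apply/asboolP; exists (b + 1 - e); split; apply: main.
by exists (MkGL uP) => //; exists a.
Qed.

Definition local_subgroup (G : set (GL R)) (e : R) : set (GL R) :=
  G `&` Gamma e.

End Corners.

(* Main.v *)
(** Replacing each [W n] by [W n `&` (W n)^-1], one may assume that the [W n]
    are symmetric. A diagonal argument with (A) gives an [n] such that every [h]
    in [G(e_n)] agrees on the corner of [e_n] with some [g] in [W n]. Conjugation
    by [h] and by [g] then coincide on [G(e_n)], so (B) puts [G(f)] inside a
    power of some [W N], and (C) does the same for [G]. *)
Require Import Defs.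
From mathcomp Require Import all_boot all_algebra.
From mathcomp Require Import boolp classical_sets cardinality.

Import GRing.Theory.

Local Open Scope classical_set_scope.
Local Open Scope ring_scope.

Section SetPow.
Context {H : groupType}.
Local Open Scope group_scope.
Implicit Types (W V : set H) (x y : H).

Lemma set_pow0 W x : set_pow W 0 x -> x = 1.
Proof. by case=> w _ <-; rewrite big_ord0. Qed.

Lemma set_powS W m x : set_pow W m.+1 x ->
  exists2 y, W y & exists2 z, set_pow W m z & x = y * z.
Proof.
case=> w wW <-; rewrite big_ord_recl; exists (w ord0); first exact: wW.
by eexists; [exists (fun i => w (lift ord0 i)) => // i; apply: wW|].
Qed.

Lemma set_pow0_1 W : set_pow W 0 1.
Proof. by exists (fun=> 1); [case|rewrite big_ord0]. Qed.

Lemma sub_set_pow1 W x : W x -> set_pow W 1 x.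
Proof.
by move=> Wx; exists (fun=> x) => //; rewrite big_ord_recl big_ord0 mulg1.
Qed.

Lemma set_powD W a b x y :
  set_pow W a x -> set_pow W b y -> set_pow W (a + b) (x * y).
Proof.
move=> [u uW <-] [v vW <-].
exists (fun i => match split i with inl j => u j | inr k => v k end).
  by move=> i /=; case: split.
rewrite big_split_ord; congr (_ * _); apply: eq_bigr => i _.
  by rewrite -[lshift _ _]/(unsplit (inl i)) unsplitK.
by rewrite -[rshift _ _]/(unsplit (inr i)) unsplitK.
Qed.

Lemma set_pow_sub W V m : W `<=` V -> set_pow W m `<=` set_pow V m.
Proof. by move=> WV _ [w wW <-]; exists w => // i; apply/WV/wW. Qed.

Lemma set_pow_comp W a b : set_pow (set_pow W a) b `<=` set_pow W (b * a).
Proof.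
elim: b => [|b IHb] x.
  by move=> /set_pow0 ->; rewrite mul0n; apply: set_pow0_1.
by move=> /set_powS[y Wy [z /IHb Wz ->]]; rewrite mulSn; apply: set_powD.
Qed.

(** A shorter product is padded on the right with factors [1]. *)
Lemma set_pow_leq W a b : W 1 -> (a <= b)%N -> set_pow W a `<=` set_pow W b.
Proof.
move=> W1 /subnKC <- x Wx; rewrite -[x]mulg1; apply: set_powD => //.
by exists (fun=> 1) => //; apply: big1.
Qed.

Lemma set_pow_subgroup G W m : is_subgroup G -> W `<=` G -> set_pow W m `<=` G.
Proof.
move=> [G1 GM _] WG; elim: m => [|m IHm] x; first by move=> /set_pow0 ->.
by move=> /set_powS[y /WG Gy [z /IHm Gz ->]]; apply: GM.
Qed.

End SetPow.

Lemma chain_sub {T : Type} {W : nat -> set T} :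
  (forall n, W n `<=` W n.+1) ->
  forall m n, (m <= n)%N -> W m `<=` W n.
Proof.
move=> Wle m n /subnKC <-; elim: (n - m)%N => [|k IHk]; first by rewrite addn0.
by rewrite addnS; apply: subset_trans IHk (Wle _).
Qed.

(** The bound is uniform in [k], so that several thresholds can later be merged by a maximum. *)
Lemma finite_sub_chain {T : choiceType} {W : nat -> set T} {F : set T} :
  (forall n, W n `<=` W n.+1) -> finite_set F -> F `<=` \bigcup_n W n ->
  exists n, forall k, (n <= k)%N -> F `<=` W k.
Proof.
move=> /chain_sub Wle /finite_seqP[s ->]; elim: s => [|x s IHs] sW.
  by exists 0%N => k _ x.
have [|n Wn] := IHs; first by move=> y ys; apply: sW; rewrite /= inE ys orbT.
have [|p _ Wp] := sW x; first by rewrite /= mem_head.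
exists (maxn n p) => k; rewrite geq_max => /andP[nk pk] y /=.
by rewrite inE => /predU1P[->|]; [apply: Wle Wp|apply: Wn].
Qed.

Section Corner.
Context {R : pzRingType}.
Implicit Types (e : R) (g h s : GL R).

Lemma Gamma_comm {e h} : idempotents e -> Gamma e h ->
  e * ring_of_GL h = ring_of_GL h * e.
Proof.
move=> ee [a [/(corner_id ee)[ea ae] _] ->].
by rewrite mulrBr mulrBl mulrDr mulrDl ea ae mulr1 mul1r.
Qed.

(** In the Peirce decomposition for [e], [k] is the identity on the corner of [e] and [s] is the
    identity on that of [1 - e], both being block diagonal. Each block therefore commutes. *)
Lemma Gamma_commute {e k s} : idempotents e -> Gamma e s ->
  e * ring_of_GL k = e -> ring_of_GL k * e = e -> (k * s = s * k)%g.
Proof.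
move=> ee [a [/(corner_id ee)[ea ae] _] sE] ek ke; apply: val_inj.
rewrite /= sE mulrBr mulrBl mulrDr mulrDl mulr1 mul1r ek ke.
by rewrite -{1}ea mulrA ke ea -{2}ae -mulrA ek ae.
Qed.

(** The quotient [k = h^-1 * g] fixes [e] on both sides, hence commutes with [s]; as [g = h * k],
    the factor [k] cancels in the conjugate by [g]. *)
Lemma Gamma_conj_eq {e g h s} : idempotents e -> Gamma e h -> Gamma e s ->
  e * ring_of_GL g = ring_of_GL g * e ->
  ring_of_GL g * e = ring_of_GL h * e ->
  (h * s * h^-1 = g * s * g^-1)%g.
Proof.
move=> ee eh es eg ge; set k := (h^-1 * g)%g.
have hVh : ring_of_GL h^-1%g * ring_of_GL h = 1.
  by rewrite -ring_of_GLM mulVg.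
have hhV : ring_of_GL h * ring_of_GL h^-1%g = 1.
  by rewrite -ring_of_GLM mulgV.
have ke : ring_of_GL k * e = e.
  by rewrite ring_of_GLM -mulrA ge mulrA hVh mul1r.
have ehV : e * ring_of_GL h^-1%g = ring_of_GL h^-1%g * e.
  rewrite -[LHS]mul1r -hVh -mulrA (mulrA _ e) -(Gamma_comm ee eh).
  by rewrite -(mulrA e) hhV mulr1.
(* Both [h^-1] and [g] commute with [e], so the left identity follows from [ke]. *)
have ek : e * ring_of_GL k = e.
  by rewrite ring_of_GLM mulrA ehV -mulrA eg -[RHS]ke ring_of_GLM mulrA.
have gE : g = (h * k)%g by rewrite mulgA mulgV mul1g.
clearbody k; rewrite gE invgM -(mulgA h k) (Gamma_commute ee es ek ke).
by rewrite !mulgA mulgK.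
Qed.

End Corner.

Section SymmetricChain.
Context {H : groupType}.
Local Open Scope group_scope.
Implicit Types (G : set H) (W : nat -> set H).

(** Intersecting each [W n] with its inverse keeps the chain increasing, and it still covers [G]
    because [x] and [x^-1] lie in a common [W n]. An inclusion suffices in the premise, since
    products of elements of [G] stay in [G]. *)
Lemma symmetric_strong_cofinality G : is_subgroup G ->
  (forall W, (forall n, W n `<=` W n.+1) -> \bigcup_n W n = G ->
     (forall n x, W n x -> W n x^-1) ->
     exists m n : nat, G `<=` set_pow (W n) m) ->
  uncountable_strong_cofinality G.
Proof.
move=> hG symG W Wle WG; have [_ _ GV] := hG.
have [n x []| |n x []|m [n GW]] := symG (fun n => W n `&` [set x | W n x^-1]).
- by split; apply: Wle.
- rewrite -WG; apply/seteqP; split=> [x [n _ [Wx _]]|x Wx]; first by exists n.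
  have [n _ Wnx] := Wx.
  have [p _ Wpx] : (\bigcup_n W n) x^-1 by rewrite WG; apply: GV; rewrite -WG.
  exists (maxn n p) => //; split; first exact: chain_sub (leq_maxl _ _) _ Wnx.
  exact: chain_sub (leq_maxr _ _) _ Wpx.
- by split; rewrite //= invgK.
exists m, n; apply/seteqP; split.
  by apply: set_pow_subgroup => // x Wx; rewrite -WG; exists n.
by apply: subset_trans GW _; apply: set_pow_sub => x [].
Qed.

End SymmetricChain.

Theorem theorem4p8 (R : pzRingType) (G : set (GL R)) (hG : is_subgroup G)
    (E : set R) (hE : E `<=` @idempotents R)
    (hA : exists2 e : nat -> R, (forall n, E (e n)) &
      forall h : nat -> GL R, (forall n, local_subgroup G (e n) (h n)) ->
      exists2 g : GL R, G g & forall n,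
        e n * ring_of_GL g = ring_of_GL g * e n /\
        ring_of_GL g * e n = ring_of_GL (h n) * e n)
    (hB : forall e : R, E e ->
      exists (F : set (GL R)) (m : nat) (f : R),
        [/\ finite_set F, F `<=` local_subgroup G e, E f &
            local_subgroup G f `<=`
              set_pow (Cl (local_subgroup G e) F) m])
    (hC : forall e : R, E e ->
      exists (F : set (GL R)) (l : nat),
        [/\ finite_set F, F `<=` G &
            G = set_pow (local_subgroup G e `|` F) l]) :
  uncountable_strong_cofinality G.
Proof.
apply: symmetric_strong_cofinality => // W Wle WG WV.
have [G1 _ _] := hG; have Wmono := chain_sub Wle.
have [e Ee eG] := hA.
have [n Wn] : exists n, forall h, local_subgroup G (e n) h -> exists2 g, W n g &
    e n * ring_of_GL g = ring_of_GL g * e n /\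
    ring_of_GL g * e n = ring_of_GL h * e n.
  (* Otherwise every [n] has some [h n] that no element of [W n] matches. By [hA] one [g] matches
     them all; it lies in some [W k], against the choice of [h k]. *)
  apply: contrapT => /forallNP bad.
  have /choice[h hP] n : exists h, local_subgroup G (e n) h /\
      ~ exists2 g, W n g & e n * ring_of_GL g = ring_of_GL g * e n /\
                           ring_of_GL g * e n = ring_of_GL h * e n.
    by have /existsNP[h /not_implyP[]] := bad n; exists h.
  have [|g Gg ge] := eG h; first by move=> n; case: (hP n).
  have [k _ Wkg] : (\bigcup_n W n) g by rewrite WG.
  by have [_] := hP k; apply; exists g.
have ee := hE _ (Ee n).
have [F [m [f [finF FG Ef fF]]]] := hB _ (Ee n).
(* (C) is used at [f] rather than at [e n], since [G(f)] is the subgroup that (B) controls. *)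
have [F' [l [finF' F'G GE]]] := hC _ Ef.
have [|p Fp] := finite_sub_chain Wle finF.
  by rewrite WG => x /FG[].
have [|p' F'p] := finite_sub_chain Wle finF'; first by rewrite WG.
have [q _ Wq1] : (\bigcup_n W n) 1%g by rewrite WG.
pose N := maxn (maxn n p) (maxn p' q).
have [nN pN p'N qN] : [/\ n <= N, p <= N, p' <= N & q <= N]%N.
  by rewrite /N; split; rewrite !leq_max leqnn ?orbT.
have WN1 : W N 1%g := Wmono _ _ qN _ Wq1.
(* The arbitrary conjugator [h] is traded for [g] in [W n]; the three factors are [g], [s] and
   [g^-1], the last by symmetry of the chain. *)
have ClF : Cl (local_subgroup G (e n)) F `<=` set_pow (W N) 3.
  move=> _ [s Fs [h Gh <-]]; have [g Wg [eg ge]] := Wn h Gh.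
  rewrite (Gamma_conj_eq ee Gh.2 (FG _ Fs).2 eg ge).
  have WNg := Wmono _ _ nN _ Wg.
  apply: (@set_powD _ _ 2 1); last exact/sub_set_pow1/WV.
  by apply: (@set_powD _ _ 1 1); apply: sub_set_pow1 => //; apply: Fp Fs.
(* [m * 3] factors reach [G(f)]. The successor keeps the exponent positive when [m = 0], so that
   [F'] is reached too. *)
exists (l * (m * 3).+1)%N, N; rewrite {1}GE.
apply: subset_trans (@set_pow_comp _ _ _ _); apply: set_pow_sub => x [fx|F'x].
  apply: (set_pow_leq _ _ _ WN1 (leqnSn _)); apply: set_pow_comp.
  exact: set_pow_sub ClF _ (fF _ fx).
apply: (set_pow_leq _ 1 _ WN1) => //.
by apply: sub_set_pow1; apply: F'p F'x.
Qed.
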